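(* Let $\alpha,\beta,\alpha',\beta'$ be nonzero ordinals, $X$ a nonempty set and $\tau$ a nonempty family of subsets of $X$. (1) If $\beta\le\beta'$ and $\alpha'\le\alpha$, then $[\beta,\alpha]$-compactness of $(X,\tau)$ implies $[\beta',\alpha']$-compactness of $(X,\tau)$. (2) $(X,\tau)$ is $[\beta,\alpha]$-compact if and only if it is $[\gamma,\gamma]$-compact for every $\gamma$ with $\beta\le\gamma\le\alpha$. (3) If $\beta\le\beta'\le\alpha$, then $(X,\tau)$ is $[\beta,\alpha]$-compact if and only if it is both $[\beta,\beta')$-compact and $[\beta',\alpha]$-compact. (4) $(X,\tau)$ is $[\beta,\alpha)$-compact if and only if it is $[\gamma,\gamma]$-compact for every $\gamma$ with $\beta\le\gamma<\alpha$.
   Context: For a nonempty set $X$, a nonempty family $\tau$ of subsets of $X$ (not necessarily a topology) and nonzero ordinals $\alpha,\beta$, $(X,\tau)$ is $[\beta,\alpha]$-compact if, whenever $(O_\delta)_{\delta\in\alpha}$ is a sequence of members of $\tau$ (repetitions allowed) with $\bigcup_{\delta\in\alpha}O_\delta=X$, there is $H\subseteq\alpha$ of order type $<\beta$ (in the induced order) with $\bigcup_{\delta\in H}O_\delta=X$. $(X,\tau)$ is $[\beta,\alpha)$-compact if it is $[\beta,\alpha']$-compact for every nonzero $\alpha'<\alpha$. *)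

(* Defs.v *)
From mathcomp Require Import all_boot.
From mathcomp Require Import boolp classical_sets wochoice.

Set Implicit Arguments.
Unset Strict Implicit.
Unset Printing Implicit Defensive.

Local Open Scope classical_set_scope.

(* An ordinal is given by any well-ordered type having that order type: two
   terms of type [Ord] denote the same ordinal iff they are order-isomorphic,
   and everything below is invariant under isomorphism.  The relation [ord_rel]
   is the non-strict order; [well_order] makes it total, antisymmetric and
   transitive.  The zero ordinal is the one with an uninhabited carrier. *)
Record Ord := MkOrd {
  ord_sort :> Type;
  ord_rel : rel ord_sort;
  ord_wo : well_order ord_rel
}.

Lemma well_order_sub (a : Ord) (H : set a) :
  well_order (fun x y : set_type H => ord_rel (val x) (val y)).
Proof.
move=> A [x0 Ax0].
have [z [[/asboolP[z' Az' zz'] lbz] uz]] :=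
  @ord_wo a (fun x => `[< exists2 y : set_type H, y \in A & val y = x >])
    (ex_intro _ (val x0) (introT (asboolP _) (ex_intro2 _ _ x0 Ax0 erefl))).
exists z'; split.
  by split=> // y Ay; rewrite zz'; apply/lbz/asboolP; exists y.
move=> y [Ay lby]; apply: val_inj; rewrite zz'; apply: uz; split.
  by apply/asboolP; exists y.
by move=> _ /asboolP[w Aw <-]; apply: lby.
Qed.

(* The order type of a subset, in the induced order. *)
Definition order_type (a : Ord) (H : set a) : Ord := MkOrd (@well_order_sub a H).

Definition ord_iso (a b : Ord) : Prop :=
  exists2 f : a -> b, bijective f & {mono f : x y / ord_rel x y}.

(* [x] is the ordinal of the elements strictly preceding it. *)
Definition ord_below (a : Ord) (x : a) : Ord :=
  order_type [set y | ord_rel y x /\ y <> x].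

Definition ord_lt (a b : Ord) : Prop := exists x : b, ord_iso a (ord_below x).

Definition ord_le (a b : Ord) : Prop := ord_lt a b \/ ord_iso a b.

(* [beta, alpha]-compactness *)
Definition compact_cc (beta alpha : Ord) (X : Type) (tau : set (set X)) : Prop :=
  forall O : alpha -> set X, (forall d, tau (O d)) ->
    \bigcup_d O d = [set: X] ->
  exists H : set alpha,
    ord_lt (order_type H) beta /\ \bigcup_(d in H) O d = [set: X].

(* [beta, alpha)-compactness *)
Definition compact_co (beta alpha : Ord) (X : Type) (tau : set (set X)) : Prop :=
  forall alpha' : Ord, inhabited alpha' -> ord_lt alpha' alpha ->
    compact_cc beta alpha' tau.

(* Main.v *)
Require Import Defs.
From mathcomp Require Import all_boot.
From mathcomp Require Import boolp classical_sets wochoice.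

Local Open Scope classical_set_scope.

(** Everything rests on one fact about well-orders: for ordinals [a] and [b],
    [a <= b] as soon as there is any strictly increasing map [a -> b], and
    [a < b] as soon as such a map has a strict upper bound in [b]
    ([increasing_ord_le], [increasing_ord_lt]).  To bound an order
    type it is then enough to produce an increasing map, whose image need not be
    an initial segment.
    The fact follows from trichotomy ([ord_trichotomy]) because an increasing
    self-map of a well-order is never bounded ([increasing_unbounded]).

    Monotonicity in the two ordinals.  A cover indexed by [alpha'] is extended
    to [alpha] by repeating the member of index 0 at every new place; that is,
    it is composed with a retraction [r : alpha -> alpha'] sending all new places
    to 0.  A subcover [H] of the extended cover gives the subcover [r @` H] of
    the original one, and the point is that its order type is at most that of
    [H].  If [H] contains new places, then [r @` H] is [H] cut down to [alpha']
    with perhaps 0 added in front; with [kappa] the type of the cut-down set,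
    this is [1 + kappa <= kappa + 1], realised by moving every element to the
    next element of [H] ([ord_le_retract]).

    Reduction to the diagonal.  Among the subcovers of an [alpha]-indexed cover
    pick one, [H], whose order type [gamma] is least possible.  If
    [gamma >= beta], then compactness for the pair (gamma, gamma), applied to
    the cover indexed by [H] itself, yields a subcover of smaller type, a
    contradiction; so [gamma < beta].

    The remaining equivalences are formal consequences of these two facts and
    of totality. *)

(** * Strict order of a well-order *)

Definition olt {a : Ord} (x y : a) : Prop := ord_rel x y /\ x <> y.

Local Notation "x <o y" := (olt x y) (at level 70, no associativity).

Definition increasing {a b : Ord} (f : a -> b) : Prop :=
  forall x y, x <o y -> f x <o f y.

Section StrictOrder.
Context {a : Ord}.
Implicit Types (x y z : a) (P : a -> Prop).

Lemma exists_least P :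
  (exists x, P x) -> exists2 m, P m & forall y, P y -> ord_rel m y.
Proof.
move=> [x Px]; have [|m [[/asboolP Pm lbm] _]] := @ord_wo a (fun y => `[< P y >]).
  by exists x; apply/asboolP.
by exists m => // y Py; apply/lbm/asboolP.
Qed.

Lemma ord_rel_refl x : ord_rel x x.
Proof. by have [|m -> ->] := exists_least (eq^~ x); first by exists x. Qed.

Lemma ord_rel_total x y : ord_rel x y \/ ord_rel y x.
Proof.
have [|m [->|->] lbm] := exists_least (fun z => z = x \/ z = y).
- by exists x; left.
- by left; apply: lbm; right.
- by right; apply: lbm; left.
Qed.

(** Antisymmetry comes from the uniqueness of the minimum of a pair. *)
Lemma ord_rel_anti x y : ord_rel x y -> ord_rel y x -> x = y.
Proof.
move=> xy yx.
have [|m [_ um]] := @ord_wo a (fun z => `[< z = x \/ z = y >]).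
  by exists x; apply/asboolP; left.
rewrite -(um x) ?(um y) //; split; try by apply/asboolP; auto.
  by move=> z /asboolP[->|->] //; apply: ord_rel_refl.
by move=> z /asboolP[->|->] //; apply: ord_rel_refl.
Qed.

Lemma ord_rel_trans x y z : ord_rel x y -> ord_rel y z -> ord_rel x z.
Proof.
move=> xy yz.
have [|m mP lbm] := exists_least (fun t => t = x \/ t = y \/ t = z).
  by exists x; left.
have mx : ord_rel m x by apply: lbm; left.
have my : ord_rel m y by apply: lbm; right; left.
have mz : ord_rel m z by apply: lbm; right; right.
case: mP => [<- //|[my'|mz']].
  by rewrite (ord_rel_anti _ _ xy) // -my'.
by rewrite -mz' (ord_rel_anti m y) // mz'.
Qed.

Lemma olt_irr x : ~ x <o x.
Proof. by case. Qed.

Lemma olt_rel_trans x y z : x <o y -> ord_rel y z -> x <o z.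
Proof.
move=> [xy neq] yz; split; first exact: ord_rel_trans yz.
by move=> xz; apply: neq; apply: ord_rel_anti => //; rewrite xz.
Qed.

Lemma rel_olt_trans x y z : ord_rel x y -> y <o z -> x <o z.
Proof.
move=> xy [yz neq]; split; first exact: ord_rel_trans yz.
by move=> xz; apply: neq; apply: ord_rel_anti => //; rewrite -xz.
Qed.

Lemma olt_trans x y z : x <o y -> y <o z -> x <o z.
Proof. by move=> xy [yz _]; apply: olt_rel_trans yz. Qed.

Lemma rel_not_olt x y : ord_rel x y -> ~ y <o x.
Proof. by move=> xy /(rel_olt_trans _ _ _ xy)/olt_irr. Qed.

Lemma not_olt_rel x y : ~ y <o x -> ord_rel x y.
Proof.
have [//|yx nyx] := ord_rel_total x y.
by have [->|/nesym ne] := pselect (x = y); [exact: ord_rel_refl|case: nyx].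
Qed.

Lemma olt_total x y : x <o y \/ x = y \/ y <o x.
Proof.
have [->|ne] := pselect (x = y); first by right; left.
by have [xy|yx] := ord_rel_total x y; [left|right; right; split; last exact: nesym].
Qed.

Lemma olt_ind P : (forall x, (forall y, y <o x -> P y) -> P x) -> forall x, P x.
Proof.
move=> step x; apply: contrapT => nPx.
have [|m nPm lbm] := exists_least (fun y => ~ P y); first by exists x.
apply/nPm/step => y ym; apply: contrapT => /lbm my.
exact: rel_not_olt my ym.
Qed.

End StrictOrder.

Section Increasing.
Context {a b : Ord}.
Implicit Types f : a -> b.

Lemma increasing_inj f : increasing f -> injective f.
Proof.
move=> fS x y fxy; have [/fS|[//|/fS]] := olt_total x y;
  by rewrite fxy => /olt_irr.
Qed.

Lemma increasing_mono f : increasing f -> {mono f : x y / ord_rel x y}.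
Proof.
move=> fS x y; apply/idP/idP => h; apply: not_olt_rel.
  by move=> /fS; apply: rel_not_olt.
move=> fyx; have [/fS xy|[xy|]] := olt_total x y.
- exact: olt_irr (olt_trans _ _ _ xy fyx).
- by move: fyx; rewrite xy => /olt_irr.
- exact: rel_not_olt.
Qed.

Lemma increasing_ord_iso f :
  increasing f -> (forall y, exists x, f x = y) -> ord_iso a b.
Proof.
move=> fS fsurj; exists f; last exact: increasing_mono.
have [g gK] := choice fsurj; exists g => // x.
exact: (increasing_inj _ fS).
Qed.

Lemma ord_iso_increasing :
  ord_iso a b -> exists2 f : a -> b, increasing f & forall y, exists x, f x = y.
Proof.
move=> [f [g fK gK] fmono]; exists f; last by move=> y; exists (g y).
by move=> x y [xy ne]; split; [rewrite fmono|move=> /(can_inj fK)].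
Qed.

End Increasing.

Lemma olt_val {a : Ord} {H : set a} (x y : order_type H) :
  x <o y <-> val x <o val y.
Proof.
by split=> -[xy ne]; split=> // e; apply: ne; [apply: val_inj|rewrite e].
Qed.

Lemma increasing_ord_lt_segment {a b : Ord} (f : a -> b) (y : b) :
  increasing f -> (forall z, z <o y <-> exists x, f x = z) -> ord_lt a b.
Proof.
move=> fS fim; exists y.
have fy x : f x <o y by apply/fim; exists x.
pose F x : ord_below y := exist _ (f x) (mem_set (fy x)).
apply: (increasing_ord_iso F); first by move=> u v uv; apply/olt_val/fS.
move=> [z zy]; have /fim[x fxz] := set_mem zy.
by exists x; apply: val_inj.
Qed.

(** The reason is that [f] satisfies [x <= f x]: a least [x] violating it would
    be dominated by [f x], another violation. *)
Lemma increasing_unbounded {a : Ord} (f : a -> a) (x : a) :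
  increasing f -> ~ forall y, f y <o x.
Proof.
move=> fS fx; have := fx x; apply: rel_not_olt; move: x {fx}.
by apply: olt_ind => x IH; apply: not_olt_rel => fxx;
  exact: rel_not_olt (IH _ fxx) (fS _ _ fxx).
Qed.

(** * Comparison of well-orders *)

(** [matched x y] says that [x] and [y] have the same rank, equivalently that
    the segments below them are isomorphic.  The back-and-forth formulation is
    symmetric in the two orders and avoids defining maps by transfinite
    recursion. *)
Inductive matched {a b : Ord} (x : a) (y : b) : Prop :=
  Matched of (forall x', x' <o x -> exists2 y', y' <o y & matched x' y')
           & (forall y', y' <o y -> exists2 x', x' <o x & matched x' y').

Section Matched.
Context {a b : Ord}.
Implicit Types (x : a) (y : b).

Lemma matched_sym x y : matched x y -> matched y x.
Proof.
move: x y; apply: olt_ind => x IH y [xy yx]; split.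
  by move=> y' /yx[x' x'x m]; exists x' => //; apply: IH.
by move=> x' x'x; have [y' y'y m] := xy _ x'x; exists y' => //; apply: IH.
Qed.

Lemma matched_fun x y y' : matched x y -> matched x y' -> y = y'.
Proof.
have key (z : a) (t t' : b) : (forall z', z' <o z -> forall u u' : b,
    matched z' u -> matched z' u' -> u = u') ->
    matched z t -> matched z t' -> ~ t <o t'.
  move=> IH [zt _] [_ t'z] /t'z[z' z'z mt].
  have [u ut mu] := zt _ z'z.
  by move: ut; rewrite (IH _ z'z _ _ mu mt) => /olt_irr.
move: x y y'; apply: olt_ind => x IH y y' m m'.
have [|[//|]] := olt_total y y'; last by move=> /(key _ _ _ IH m' m).
by move=> /(key _ _ _ IH m m').
Qed.

Lemma matched_increasing x x' y y' :
  matched x y -> matched x' y' -> x <o x' -> y <o y'.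
Proof.
by move=> m [xy _] /xy[z zy' mz]; rewrite (matched_fun _ _ _ m mz).
Qed.

(** Two least unmatched elements would match each other, so one of the two
    orders is matched entirely. *)
Lemma matched_total :
  (forall x, exists y, matched x y) \/ (forall y, exists x, matched x y).
Proof.
apply: contrapT => /not_orP[/existsNP nx /existsNP ny].
have [x0 nx0 lbx] := exists_least _ nx; have [y0 ny0 lby] := exists_least _ ny.
have ex x : x <o x0 -> exists y, matched x y.
  by move=> xx0; apply: contrapT => /lbx /rel_not_olt.
have ey y : y <o y0 -> exists x, matched x y.
  by move=> yy0; apply: contrapT => /lby /rel_not_olt.
apply: (nx0); exists y0; split.
  move=> x /[dup] xx0 /ex[y m]; exists y => //.
  have [//|[yy0|y0y]] := olt_total y y0; exfalso; apply: ny0.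
    by exists x; rewrite -yy0.
  by case: m => _ /(_ _ y0y)[x' _ m']; exists x'.
move=> y /[dup] yy0 /ey[x m]; exists x => //.
have [//|[xx0|x0x]] := olt_total x x0; exfalso; apply: nx0.
  by exists y; rewrite -xx0.
by case: m => /(_ _ x0x)[y' _ m'] _; exists y'.
Qed.

End Matched.

Lemma matched_choice {a b : Ord} :
  (forall x : a, exists y : b, matched x y) ->
  exists2 f : a -> b, increasing f & forall x, matched x (f x).
Proof.
move=> /choice[f fm]; exists f => // x y xy.
exact: matched_increasing (fm x) (fm y) xy.
Qed.

Lemma matched_ord_le {a b : Ord} :
  (forall x : a, exists y : b, matched x y) -> ord_le a b.
Proof.
move=> /matched_choice[f fS fm].
have [fsurj|/existsNP nfsurj] := pselect (forall y, exists x, f x = y).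
  by right; apply: increasing_ord_iso fsurj.
have [y0 ny0 lby] := exists_least _ nfsurj.
left; apply: (increasing_ord_lt_segment f y0 fS) => z; split.
  by move=> zy0; apply: contrapT => /lby/rel_not_olt.
move=> [x <-]; have [//|[fxy|y0fx]] := olt_total (f x) y0; exfalso; apply: ny0.
  by exists x.
have [_ /(_ _ y0fx)[x' _ m]] := fm x.
by exists x'; apply: matched_fun (fm x') m.
Qed.

Lemma ord_lt_increasing {a b : Ord} :
  ord_lt a b -> exists (f : a -> b) (y : b),
    increasing f /\ forall z, z <o y <-> exists x, f x = z.
Proof.
move=> [y /ord_iso_increasing[f fS fsurj]].
exists (fun x => val (f x)), y; split; first by move=> u v /fS/olt_val.
move=> z; split=> [zy|[x <-]]; last exact: set_mem (valP (f x)).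
have [x fx] := fsurj (exist _ z (mem_set zy)).
by exists x; rewrite fx.
Qed.

Lemma ord_iso_sym (a b : Ord) : ord_iso a b -> ord_iso b a.
Proof.
by move=> [f [g fK gK] fm]; exists g; [exists f|move=> x y; rewrite -fm !gK].
Qed.

Lemma ord_trichotomy (a b : Ord) : ord_lt a b \/ ord_iso a b \/ ord_lt b a.
Proof.
have [/matched_ord_le[]|h] := @matched_total a b; [by left|by right; left|].
have [|ba|/ord_iso_sym] := @matched_ord_le b a; [|by right; right|by right; left].
by move=> y; have [x /matched_sym] := h y; exists x.
Qed.

Section IncreasingCriteria.
Context {a b : Ord} (f : a -> b).
Hypothesis f_increasing : increasing f.

Lemma increasing_ord_le : ord_le a b.
Proof.
have [|[|]] := ord_trichotomy a b; [by left|by right|].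
move=> /ord_lt_increasing[g [x [gS gx]]]; exfalso.
apply: (@increasing_unbounded _ (g \o f) x) => [u v /f_increasing/gS //|u].
by apply/gx; exists (f u).
Qed.

Lemma increasing_ord_lt (y : b) : (forall x, f x <o y) -> ord_lt a b.
Proof.
move=> fy; have [|/ord_iso_sym/ord_iso_increasing[g gS _]] := increasing_ord_le.
  by [].
exfalso; apply: (@increasing_unbounded _ (f \o g) y) => [u v /gS/f_increasing //|u].
exact: fy.
Qed.

End IncreasingCriteria.

Lemma ord_le_increasing {a b : Ord} :
  ord_le a b -> exists2 f : a -> b, increasing f &
    forall x y, y <o f x -> exists x', f x' = y.
Proof.
move=> [/ord_lt_increasing[f [y [fS fy]]]|/ord_iso_increasing[f fS fsurj]].
  exists f => // x z zfx; apply/fy; apply: olt_trans zfx _.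
  by apply/fy; exists x.
by exists f.
Qed.

Lemma ord_le_refl (a : Ord) : ord_le a a.
Proof. exact: (@increasing_ord_le _ _ id). Qed.

Lemma ord_le_lt_trans {a b c : Ord} : ord_le a b -> ord_lt b c -> ord_lt a c.
Proof.
move=> /ord_le_increasing[f fS _] /ord_lt_increasing[g [z [gS gz]]].
apply: (@increasing_ord_lt _ _ (g \o f) _ z) => [x y /fS/gS //|x].
by apply/gz; exists (f x).
Qed.

Lemma ord_lt_le_trans {a b c : Ord} : ord_lt a b -> ord_le b c -> ord_lt a c.
Proof.
move=> /ord_lt_increasing[f [y [fS fy]]] /ord_le_increasing[g gS _].
apply: (@increasing_ord_lt _ _ (g \o f) _ (g y)) => [u v /fS/gS //|x].
by apply: gS; apply/fy; exists x.
Qed.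

Lemma ord_le_total (a b : Ord) : ord_lt a b \/ ord_le b a.
Proof.
have [|[/ord_iso_sym|]] := ord_trichotomy a b; [by left|by right; right|].
by right; left.
Qed.

(** * Order types of subsets *)

Lemma order_type_le {a : Ord} (H : set a) : ord_le (order_type H) a.
Proof. by apply: (@increasing_ord_le (order_type H) a val) => x y /olt_val. Qed.

Lemma order_type_le_on {a b : Ord} (H : set a) (K : set b) (f : a -> b) :
  (forall x, H x -> K (f x)) ->
  (forall x y, H x -> H y -> x <o y -> f x <o f y) ->
  ord_le (order_type H) (order_type K).
Proof.
move=> fHK fS.
have HP (x : order_type H) : H (val x) := set_mem (valP x).
pose F x : order_type K := exist _ (f (val x)) (mem_set (fHK _ (HP x))).
apply: (@increasing_ord_le (order_type H) (order_type K) F) => x y /olt_val xy.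
exact/olt_val/fS.
Qed.

(** The retraction [r] collapses everything outside the initial segment
    [e @` setT] to the least element [x0].  When [H] leaves the segment, the map
    [x |-> least element of H above e x] is increasing on [r @` H]: if [x < y]
    then [y <> x0], so [e y] is itself in [H] and bounds the image of [x]. *)
Lemma ord_le_retract {a b : Ord} (e : a -> b) (r : b -> a) (x0 : a) (H : set b) :
    increasing e -> (forall x y, y <o e x -> exists x', e x' = y) ->
    (forall x, ord_rel x0 x) ->
    cancel e r -> (forall y, ~ (exists x, e x = y) -> r y = x0) ->
  ord_le (order_type (r @` H)) (order_type H).
Proof.
move=> eS edown x0le eK rout.
have [Hin|/existsNP[h /not_implyP[Hh hout]]] :=
    pselect (forall h, H h -> exists x, e x = h).
  apply: (order_type_le_on _ _ e) => [_ [y Hy <-]|x y _ _ /eS //].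
  by have [x ex] := Hin _ Hy; rewrite -ex eK ex.
have eh x : e x <o h.
  have [//|[exh|/edown //]] := olt_total (e x) h.
  by case: hout; exists x.
have rH y : (r @` H) y -> x0 <o y -> H (e y).
  move=> [z Hz <-] x0z.
  have [[x exz]|zout] := pselect (exists x, e x = z); first by rewrite -exz eK exz.
  by move: x0z; rewrite (rout _ zout) => /olt_irr.
have [|g gP] := choice (P := fun x z => [/\ H z, e x <o z &
    forall t, H t -> e x <o t -> ord_rel z t]) => [x|].
  have [|z [Hz xz] zmin] := @exists_least _ (fun t => H t /\ e x <o t).
    by exists h.
  by exists z; split=> // t Ht xt; apply: zmin.
apply: (order_type_le_on _ _ g) => [x _|x y _ ry xy]; first by have [] := gP x.
have [_ _ gmin] := gP x; have [_ eyg _] := gP y.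
apply: rel_olt_trans eyg; apply: gmin; last exact: eS.
exact: rH (rel_olt_trans _ _ _ (x0le x) xy).
Qed.

(** * Compactness *)

Section Compactness.
Context {X : Type} {tau : set (set X)}.
Implicit Types a b c : Ord.

Lemma ord_le_inhabited {a b} : inhabited a -> ord_le a b -> inhabited b.
Proof. by move=> [x] /ord_le_increasing[f _ _]; exists; exact: f x. Qed.

(** A cover indexed by [a'] is pulled back along a retraction of [a] onto [a'];
    the image of a subcover under the retraction covers the same set. *)
Lemma compact_cc_mono {a b a' b'} : inhabited a' -> ord_le b b' ->
  ord_le a' a -> compact_cc b a tau -> compact_cc b' a' tau.
Proof.
move=> [x1] leb /ord_le_increasing[e eS edown] cmp O tauO covO.
have [|x0 _ x0min] := @exists_least a' (fun=> True); first by exists x1.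
have x0le x : ord_rel x0 x by exact: x0min.
have [|r rP] := choice (P := fun y x =>
    e x = y \/ (~ exists x', e x' = y) /\ x = x0) => [y|].
  have [[x <-]|yout] := pselect (exists x, e x = y); first by exists x; left.
  by exists x0; right.
have eK : cancel e r.
  move=> x; have [/(increasing_inj _ eS) //|[[]]] := rP (e x).
  by exists x.
have rout y : ~ (exists x, e x = y) -> r y = x0.
  by move=> yout; have [ey|[]//] := rP y; case: yout; exists (r y).
have [|H [ltH covH]] := cmp (O \o r) (fun y => tauO (r y)).
  apply/seteqP; split=> // z _.
  have [x _ Oxz] : (\bigcup_d O d) z by rewrite covO.
  by exists (e x) => //=; rewrite eK.
exists (r @` H); split; last by rewrite bigcup_image.
apply: ord_lt_le_trans leb; apply: ord_le_lt_trans ltH.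
exact: ord_le_retract eS edown x0le eK rout.
Qed.

(** For the converse, a subcover of least order type is itself an indexed cover
    to which the diagonal hypothesis applies, unless its type is below [b]. *)
Lemma compact_cc_diag {a b} : inhabited b ->
  (compact_cc b a tau <->
   forall c, ord_le b c -> ord_le c a -> compact_cc c c tau).
Proof.
move=> b0; split=> [cmp c bc ca|diag O tauO covO].
  exact: compact_cc_mono (ord_le_inhabited b0 bc) bc ca cmp.
have [ab|ba] := ord_le_total a b.
  exists setT; split=> //; apply: ord_le_lt_trans ab; exact: order_type_le.
(* Order types of subcovers are compared through bounded increasing maps into
   [a], so that the least one is found by minimising over elements of [a]. *)
pose small (x : a) := exists H : set a, \bigcup_(d in H) O d = setT /\
  exists f : order_type H -> a, increasing f /\ forall h, f h <o x.
have [|x [H [covH [f [fS fx]]]] xmin] := @exists_least _ small.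
  have [H [/ord_lt_increasing[f [x [fS fx]]] covH]] :=
    diag _ ba (ord_le_refl a) O tauO covO.
  exists x, H; split=> //; exists f; split=> // h.
  by apply/fx; exists h.
exists H; split=> //.
have [//|bH] := ord_le_total (order_type H) b; exfalso.
have [||K [/ord_lt_increasing[g [y [gS gy]]] covK]] :=
    diag _ bH (order_type_le H) (O \o val).
- by move=> d; apply: tauO.
- by rewrite -covH [RHS]bigcup_set_type.
(* Shrinking [H] to [K] lowers the bound from [x] to [f y], against the choice
   of [x]. *)
suff /xmin /rel_not_olt : small (f y) by apply; apply: fx.
exists (val @` K); split; first by rewrite bigcup_image.
have KP (d : order_type (val @` K)) : exists k : order_type K, val (val k) = val d.
  have [k Kk kd] := set_mem (valP d).
  by exists (exist _ k (mem_set Kk)).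
have [k kP] := choice KP.
exists (fun d => f (g (k d))); split.
  by move=> d d' /olt_val; rewrite -!kP => dd'; apply/fS/gS/olt_val/olt_val.
by move=> d; apply/fS/gy; exists (k d).
Qed.

(** Each diagonal instance [c] lies either below [b'] or above it. *)
Lemma compact_cc_split {a b b'} : inhabited b -> inhabited b' ->
  ord_le b b' -> ord_le b' a ->
  (compact_cc b a tau <-> compact_co b b' tau /\ compact_cc b' a tau).
Proof.
move=> b0 b'0 bb' b'a; split=> [cmp|[cmpo cmpc]].
  split=> [c c0 cb'|]; last first.
    exact: compact_cc_mono (ord_le_inhabited b'0 b'a) bb' (ord_le_refl a) cmp.
  apply: compact_cc_mono c0 (ord_le_refl b) _ cmp.
  by left; apply: ord_lt_le_trans cb' b'a.
apply/compact_cc_diag => // c bc ca.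
have c0 := ord_le_inhabited b0 bc.
have [cb'|b'c] := ord_le_total c b'.
  exact: compact_cc_mono c0 bc (ord_le_refl c) (cmpo c c0 cb').
exact: compact_cc_mono c0 b'c ca cmpc.
Qed.

Lemma compact_co_diag {a b} : inhabited b ->
  (compact_co b a tau <->
   forall c, ord_le b c -> ord_lt c a -> compact_cc c c tau).
Proof.
move=> b0; split=> [cmp c bc ca|diag c c0 ca].
  have c0 := ord_le_inhabited b0 bc.
  exact: compact_cc_mono c0 bc (ord_le_refl c) (cmp c c0 ca).
apply/compact_cc_diag => // d bd dc.
exact: diag bd (ord_le_lt_trans dc ca).
Qed.

End Compactness.

Theorem proposition2p3 (alpha beta alpha' beta' : Ord)
    (alpha_gt0 : inhabited alpha) (beta_gt0 : inhabited beta)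
    (alpha'_gt0 : inhabited alpha') (beta'_gt0 : inhabited beta')
    (X : Type) (X_nonempty : inhabited X)
    (tau : set (set X)) (tau_nonempty : tau !=set0) :
  (ord_le beta beta' -> ord_le alpha' alpha ->
     compact_cc beta alpha tau -> compact_cc beta' alpha' tau)
  /\ (compact_cc beta alpha tau <->
      forall gamma : Ord, ord_le beta gamma -> ord_le gamma alpha ->
        compact_cc gamma gamma tau)
  /\ (ord_le beta beta' -> ord_le beta' alpha ->
      (compact_cc beta alpha tau <->
       compact_co beta beta' tau /\ compact_cc beta' alpha tau))
  /\ (compact_co beta alpha tau <->
      forall gamma : Ord, ord_le beta gamma -> ord_lt gamma alpha ->
        compact_cc gamma gamma tau).
Proof.
split; first exact: compact_cc_mono.
split; first exact: compact_cc_diag.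
split; first exact: compact_cc_split.
exact: compact_co_diag.
Qed.
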